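(* Let $I=(g_1,\dots,g_p)\subset\mathcal{O}_n$ and suppose $f=\sum_{i,j=1}^{p}h_{i,j}g_ig_j$ with $h_{i,j}=h_{j,i}\in\mathcal{O}_n$ and $\det[H(0)]\ne0$, where $[H]$ is the symmetric matrix with entries $h_{i,j}$. Let $z_1,\dots,z_p$ be coordinates on $\mathbb{C}^p$. Then generators $(g'_1,\dots,g'_p)$ of $I$ can be chosen so that $$f=\sum_{i=1}^{p}z_i^2\circ G',$$ where $G'$ is the map-germ with components $g'_1,\dots,g'_p$.
   Context: $\mathcal{O}_n$ is the ring of germs at $0$ of holomorphic functions on $\mathbb{C}^n$. *)

(* Defs.v *)
From HB Require Import structures.
From mathcomp Require Import all_boot all_order all_algebra.
From mathcomp Require Import generic_quotient ring_quotient complex.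
From mathcomp Require Import all_classical all_reals all_analysis.

Set Implicit Arguments.
Unset Strict Implicit.
Unset Printing Implicit Defensive.

Import Order.TTheory GRing.Theory Num.Theory.
Import numFieldNormedType.Exports.

Local Open Scope classical_set_scope.
Local Open Scope ring_scope.
Local Open Scope quotient_scope.

(* Everything below is stated over an arbitrary numFieldType K, so that K       *)
(* carries the topology given by its norm; it is meant for K = R[i] with R a    *)
(* realType.  Differentiability is Fréchet differentiability over K, hence over *)
(* R[i] "differentiable at every point of an open set" is "holomorphic".        *)

Section Entire.
Variables (K : numFieldType) (n : nat).

Definition entire_pred : {pred 'rV[K]_n -> K} :=
  fun f => `[< forall z, differentiable f z >].

Lemma entire_subring : subring_closed entire_pred.
Proof.
split=> [|f g /asboolP df /asboolP dg|f g /asboolP df /asboolP dg].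
- by apply/asboolP => z; exact: differentiable_cst.
- by apply/asboolP => z; exact: differentiableB.
- by apply/asboolP => z; exact: differentiableM.
Qed.

HB.instance Definition _ :=
  GRing.isSubringClosed.Build _ entire_pred entire_subring.

Record entire :=
  Entire { entire_val :> 'rV[K]_n -> K; _ : entire_val \in entire_pred }.

HB.instance Definition _ := [isSub for entire_val].
HB.instance Definition _ := [Choice of entire by <:].
HB.instance Definition _ := 
  GRing.SubChoice_isSubComPzRing.Build _ _ entire entire_subring.

Lemma entireP (f : entire) z : differentiable f z.
Proof. by case: f => f /= /asboolP; exact. Qed.

Fact zcoord_entire (i : 'I_n) :
  (fun z : 'rV[K]_n => z ord0 i) \in entire_pred.
Proof. by apply/asboolP => z; exact: differentiable_coord. Qed.

Definition zcoord (i : 'I_n) : entire := Entire (zcoord_entire i).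

End Entire.

Section Germs.
Variables (K : numFieldType) (n : nat).

Definition holo0_pred : {pred 'rV[K]_n -> K} :=
  fun f => `[< \forall z \near (0 : 'rV[K]_n), differentiable f z >].

Lemma holo0_subring : subring_closed holo0_pred.
Proof.
split=> [|f g /asboolP df /asboolP dg|f g /asboolP df /asboolP dg].
- by apply/asboolP; near=> z; exact: differentiable_cst.
- by apply/asboolP; near=> z; apply: differentiableB; near: z.
- by apply/asboolP; near=> z; apply: differentiableM; near: z.
Unshelve. all: by end_near. Qed.

HB.instance Definition _ :=
  GRing.isSubringClosed.Build _ holo0_pred holo0_subring.

(* Total functions that are holomorphic on some neighbourhood of 0; their       *)
(* values away from 0 are irrelevant, and are forgotten by the quotient below.  *)
Record holo0 :=
  Holo0 { holo0_val :> 'rV[K]_n -> K; _ : holo0_val \in holo0_pred }.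

HB.instance Definition _ := [isSub for holo0_val].
HB.instance Definition _ := [Choice of holo0 by <:].
HB.instance Definition _ := 
  GRing.SubChoice_isSubComPzRing.Build _ _ holo0 holo0_subring.

Lemma holo0P (f : holo0) :
  \forall z \near (0 : 'rV[K]_n), differentiable f z.
Proof. by case: f => f /= /asboolP. Qed.

Fact holo0_nonzero : (1 : holo0) != 0.
Proof.
apply/eqP => /(congr1 (fun f : holo0 => f 0)) /= /eqP.
by rewrite (oner_eq0 K).
Qed.
HB.instance Definition _ :=
  GRing.PzSemiRing_isNonZero.Build holo0 holo0_nonzero.

Definition null0 : {pred holo0} :=
  fun f => `[< \forall z \near (0 : 'rV[K]_n), f z = 0 >].

Lemma null0_idealr : idealr_closed null0.
Proof.
split.
- by apply/asboolP; near=> z.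
- apply/negP => /asboolP /nbhs_singleton /eqP.
  by rewrite (oner_eq0 K).
- move=> a f g /asboolP f0 /asboolP g0; apply/asboolP; near=> z.
  have fz : f z = 0 by near: z.
  have gz : g z = 0 by near: z.
  by rewrite -[LHS]/(a z * f z + g z) fz gz mulr0 addr0.
Unshelve. all: by end_near. Qed.

HB.instance Definition _ := isIdealr.Build _ null0 null0_idealr.

(* The ring O_n of germs at 0: functions holomorphic near 0 modulo equality     *)
(* on a neighbourhood of 0.                                                     *)
Definition germ : Type := {ideal_quot null0}.
HB.instance Definition _ := GRing.ComNzRing.on germ.

Definition germ_of (f : holo0) : germ := \pi_{ideal_quot null0} f.
Definition germ_repr (u : germ) : holo0 := repr (u : {ideal_quot null0}).

Lemma germ_reprK u : germ_of (germ_repr u) = u.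
Proof. exact: reprK. Qed.

Lemma germ_ofP (f g : holo0) :
  germ_of f = germ_of g <-> \forall z \near (0 : 'rV[K]_n), f z = g z.
Proof.
split=> [/eqP|fg]; last apply/eqP.
  rewrite -Quotient.idealrBE => /asboolP fg; near=> z.
  by apply/eqP; rewrite -subr_eq0; apply/eqP; near: z.
rewrite -Quotient.idealrBE; apply/asboolP; near=> z.
have fgz : f z = g z by near: z.
by rewrite -[LHS]/(f z - g z) fgz subrr.
Unshelve. all: by end_near. Qed.

Lemma germ_ofD f g : germ_of (f + g) = germ_of f + germ_of g.
Proof. exact: rmorphD. Qed.

Lemma germ_ofM f g : germ_of (f * g) = germ_of f * germ_of g.
Proof. exact: rmorphM. Qed.

Definition germ_at0 (u : germ) : K := germ_repr u 0.

Lemma germ_at0E f : germ_at0 (germ_of f) = f 0.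
Proof. by have /germ_ofP/nbhs_singleton := germ_reprK (germ_of f). Qed.

Section Composition.
Variable p : nat.

Fact comp_holo0 (phi : entire K p) (g : 'I_p -> holo0) :
  (fun z => phi (\row_i g i z)) \in holo0_pred.
Proof.
apply/asboolP.
have dg : \forall z \near (0 : 'rV[K]_n), forall i, differentiable (g i) z.
  apply: (@filter_forall _ _ (fun i z => differentiable (g i) z)
    (nbhs (0 : 'rV[K]_n))) => i.
  exact: holo0P.
near=> z.
suff dG : differentiable (fun x : 'rV[K]_n => \row_i g i x) z.
  exact: (differentiable_comp dG (entireP phi _)).
have -> : (fun x : 'rV[K]_n => \row_i g i x) =
    \sum_(i < p) (fun x => g i x *: (delta_mx 0 i : 'rV[K]_p)).
  apply/funext => x; rewrite fct_sumE [LHS]row_sum_delta.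
  by apply: eq_bigr => i _; rewrite mxE.
apply: differentiable_sum => i; apply: differentiableZl.
by move: i; near: z.
Unshelve. all: by end_near. Qed.

(* phi \o G, where G is the map-germ to K^p with components G i.              *)
Definition germ_comp (phi : entire K p) (G : 'I_p -> germ) : germ :=
  germ_of (Holo0 (comp_holo0 phi (fun i => germ_repr (G i)))).

Lemma germ_compE (phi : entire K p) (g : 'I_p -> holo0) :
  germ_comp phi (fun i => germ_of (g i)) = germ_of (Holo0 (comp_holo0 phi g)).
Proof.
apply/germ_ofP => /=.
have eg : \forall z \near (0 : 'rV[K]_n),
    forall i, germ_repr (germ_of (g i)) z = g i z.
  apply: (@filter_forall _ _
    (fun i z => germ_repr (germ_of (g i)) z = g i z)
    (nbhs (0 : 'rV[K]_n))) => i.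
  exact/germ_ofP/germ_reprK.
near=> z; congr (phi _); apply/rowP => i; rewrite !mxE.
by move: i; near: z.
Unshelve. all: by end_near. Qed.

End Composition.
End Germs.

Arguments zcoord {K n}.
Arguments germ_at0 {K n}.

(* The ideal (g_0, ..., g_(p-1)).                                               *)
Definition ideal_gen (A : comNzRingType) (p : nat) (g : 'I_p -> A) : set A :=
  [set f | exists a : 'I_p -> A, f = \sum_(i < p) a i * g i].

(* Main.v *)
From HB Require Import structures.
Require Import Defs.
From mathcomp Require Import all_boot all_order all_fingroup all_algebra ring complex.
From mathcomp Require Import all_classical all_reals all_analysis.
Set Implicit Arguments.
Unset Strict Implicit.
Unset Printing Implicit Defensive.
Import Order.TTheory GRing.Theory Num.Theory.
Import numFieldNormedType.Exports.
Local Open Scope classical_set_scope.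
Local Open Scope ring_scope.

(** The value at 0 is a ring morphism from the ring of germs to the field of
    constants that detects units: a germ that does not vanish at 0 is
    invertible ([germ_inverse]) and, when every constant is a square, is itself
    a square ([germ_square_root]).  Over such a ring, in which 2 is invertible, a
    symmetric matrix [h] whose determinant is a unit is diagonalised by
    congruence just as over a field: a pivot is brought to the corner
    ([exists_pivot]), its square root is extracted, and the procedure goes on
    with the Schur complement.  This gives [h = B^T *m B] ([symmetric_gram]),
    where [B] is invertible since its determinant is a unit.

    If [gv] is the column of the generators, then
    [f = gv^T *m h *m gv = (B *m gv)^T *m (B *m gv)], so the entries of
    [B *m gv] are germs whose squares add up to [f]; they generate the same
    ideal because [B] is invertible. *)

(** * Symmetric matrices over a local ring with square roots *)

(** [eps] plays the part of the residue map: the last two hypotheses say that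
    every element outside its kernel is a unit and a square. *)
Section SumOfSquares.
Variables (A : comNzRingType) (K : fieldType) (eps : {rmorphism A -> K}).
Hypothesis two_neq0 : (2%:R : K) != 0.
Hypothesis inverse : forall u, eps u != 0 -> exists v, v * u = 1.
Hypothesis square_root : forall u, eps u != 0 -> exists s, s ^+ 2 = u.

Lemma left_inverse_mx p (P : 'M[A]_p) :
  \det (map_mx eps P) != 0 -> exists Q, Q *m P = 1%:M.
Proof.
rewrite det_map_mx => /inverse[v vP]; exists (v *: \adj P).
by rewrite -scalemxAl mul_adj_mx scale_scalar_mx vP.
Qed.

(** A congruence by an invertible matrix affects neither the conclusion nor the
    hypotheses of [symmetric_gram]; this and the next two lemmas allow [h] to be
    replaced by [P *m h *m P^T]. *)
Lemma congruent_gram p (h P Q : 'M[A]_p) : Q *m P = 1%:M ->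
  (exists B : 'M[A]_p, P *m h *m P^T = B^T *m B) -> exists B : 'M[A]_p, h = B^T *m B.
Proof.
move=> QP [B hB]; exists (B *m Q^T); rewrite trmx_mul trmxK !mulmxA.
rewrite -(mulmxA Q B^T B) -hB !mulmxA QP mul1mx -mulmxA -trmx_mul QP trmx1.
by rewrite mulmx1.
Qed.

Lemma congruent_det p (h P Q : 'M[A]_p) : Q *m P = 1%:M ->
  \det (map_mx eps h) != 0 -> \det (map_mx eps (P *m h *m P^T)) != 0.
Proof.
move=> QP h0; rewrite !map_mxM -map_trmx !det_mulmx det_tr !mulf_neq0 //.
all: have /(congr1 (fun M => \det (map_mx eps M))) := QP;
  rewrite map_mxM map_mx1 det_mulmx det1 => /eqP; apply: contraTneq => ->;
  by rewrite mulr0 eq_sym oner_eq0.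
Qed.

Lemma congruent_sym p (h P : 'M[A]_p) : h^T = h ->
  (P *m h *m P^T)^T = P *m h *m P^T.
Proof. by move=> hT; rewrite !trmx_mul trmxK hT mulmxA. Qed.

(** One step of the Cholesky algorithm: with [t] the inverse of [s], the factor
    [block_mx s%:M (t *: b) 0 B] accounts for the pivot row and column, and [B]
    for the Schur complement of the pivot. *)
Lemma gram_block p (a : 'M[A]_1) (b : 'M[A]_(1, p)) (d B : 'M[A]_p)
    (s t : A) :
  a = (s ^+ 2)%:M -> t * s = 1 ->
  d - t ^+ 2 *: (b^T *m b) = B^T *m B ->
  block_mx a b b^T d =
  (block_mx s%:M (t *: b) 0 B)^T *m (block_mx s%:M (t *: b) 0 B).
Proof.
move=> -> ts /(canRL (subrK _)) ->.
rewrite tr_block_mx mulmx_block trmx0 tr_scalar_mx !mul0mx !mulmx0 !addr0.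
rewrite -scalar_mxM mul_scalar_mx scalerA mul_mx_scalar linearZ /= scalerA.
rewrite -scalemxAl -scalemxAr scalerA addrC -!expr2.
by rewrite (mulrC s t) ts !scale1r.
Qed.

(** Block Gaussian elimination below the pivot [a], which shows that the Schur
    complement again has a unit determinant. *)
Lemma pivot_schur_det p (a t : A) (b : 'M[A]_(1, p)) (d : 'M[A]_p) :
  t * a = 1 -> \det (block_mx a%:M b b^T d) =
  a * \det (d - t *: (b^T *m b)).
Proof.
move=> ta.
have -> : block_mx a%:M b b^T d =
   block_mx 1%:M 0 (t *: b^T) 1%:M *m block_mx a%:M b 0 (d - t *: (b^T *m b)).
  rewrite mulmx_block !mul1mx !mul0mx !addr0 mul_mx_scalar scalerA.
  by rewrite mulrC ta scale1r -scalemxAl addrC subrK.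
by rewrite det_mulmx det_lblock det_ublock !det1 !mul1r det_scalar1.
Qed.

(** A diagonal entry that is a unit is moved to the corner by a transposition.
    If there is none, some [h i j] with [i != j] is a unit, as the determinant
    would otherwise vanish under [eps]; adding row and column [j] to row and
    column [i] turns the entry [(i, i)] into [h i i + 2 h i j + h j j], which
    has residue [2 * eps (h i j)]. *)
Lemma exists_pivot p (h : 'M[A]_p.+1) : h^T = h ->
  \det (map_mx eps h) != 0 ->
  exists P Q : 'M[A]_p.+1, Q *m P = 1%:M /\ eps ((P *m h *m P^T) 0 0) != 0.
Proof.
move=> hT h0.
have diag (k : 'M[A]_p.+1) i : eps (k i i) != 0 ->
    exists P Q : 'M[A]_p.+1, Q *m P = 1%:M /\ eps ((P *m k *m P^T) 0 0) != 0.
  move=> kii; pose P : 'M[A]_p.+1 := perm_mx (tperm 0 i).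
  exists P, P; split; first by rewrite -perm_mxM tperm2 perm_mx1.
  by rewrite tr_perm_mx -row_permE -col_permE !mxE tpermL.
have [[i hii]|hdiag] := pselect (exists i, eps (h i i) != 0).
  exact: diag hii.
have {}hdiag i : eps (h i i) = 0.
  by apply/eqP/negP => /negP hii; apply: hdiag; exists i.
have [[i [j hij]]|hz] := pselect (exists i j, eps (h i j) != 0); last first.
  case/negP: h0; suff -> : map_mx eps h = 0 by rewrite det0.
  apply/matrixP => i j; rewrite !mxE; apply/eqP/negP => /negP hij.
  by apply: hz; exists i, j.
have neq_ij : j != i by apply: contra_neq hij => ->.
pose E : 'M[A]_p.+1 := delta_mx i j.
have EE : E *m E = 0 by rewrite mul_delta_mx_0.
have QP : (1%:M - E) *m (1%:M + E) = 1%:M.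
  by rewrite mulmxDr mulmx1 mulmxBl mul1mx EE subr0 subrK.
have Er M k : ((1%:M + E) *m M) i k = M i k + M j k :> A.
  rewrite mulmxDl mul1mx mxE; congr (_ + _).
  rewrite mxE (bigD1 j) //= big1 => [|l /negbTE lj].
    by rewrite mxE !eqxx mul1r addr0.
  by rewrite mxE lj andbF mul0r.
have hE : ((1%:M + E) *m h *m (1%:M + E)^T) i i =
    h i i + h j i + (h i j + h j j).
  have -> : ((1%:M + E) *m h *m (1%:M + E)^T) i i =
      ((1%:M + E) *m ((1%:M + E) *m h)^T) i i.
    by rewrite -[in LHS](trmxK (_ *m h)) -trmx_mul mxE.
  by rewrite Er ![_^T _ _]mxE !Er addrACA.
have : eps (((1%:M + E) *m h *m (1%:M + E)^T) i i) != 0.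
  rewrite hE !rmorphD !hdiag add0r addr0.
  have -> : h j i = h i j by rewrite -{1}hT mxE.
  by rewrite -mulr2n -mulr_natl mulf_neq0.
move/diag => [P [Q [QP' PP]]].
exists (P *m (1%:M + E)), ((1%:M - E) *m Q); split.
  by rewrite mulmxA -(mulmxA _ Q) QP' mulmx1.
by move: PP; rewrite trmx_mul !mulmxA.
Qed.

Lemma symmetric_gram p (h : 'M[A]_p) : h^T = h ->
  \det (map_mx eps h) != 0 -> exists B : 'M[A]_p, h = B^T *m B.
Proof.
elim: p h => [|p IHp] h hT h0; first by exists 0; apply/matrixP => -[].
have [P [Q [QP pivot]]] := exists_pivot hT h0.
apply: (congruent_gram QP).
move: (congruent_det QP h0) (congruent_sym P hT) pivot.
move: (P *m h *m P^T) => k {h P Q QP hT h0} k0 kT pivot.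
have [s sk] := square_root pivot.
have /inverse[t ts] : eps s != 0.
  by apply: contraNneq pivot => s0; rewrite -sk rmorphXn /= s0 expr0n.
pose b := ursubmx (k : 'M[A]_(1 + p)); pose d := drsubmx (k : 'M[A]_(1 + p)).
have ka : ulsubmx (k : 'M[A]_(1 + p)) = (s ^+ 2)%:M.
  rewrite [LHS]mx11_scalar sk !mxE; congr (k _ _)%:M; exact: val_inj.
have kE : k = block_mx (s ^+ 2)%:M b b^T d.
  by rewrite -ka -[LHS](submxK (k : 'M[A]_(1 + p))) trmx_ursub kT.
have [||B hB] := IHp (d - t ^+ 2 *: (b^T *m b)).
- rewrite linearB linearZ /= trmx_mul trmxK; congr (_ - _).
  by rewrite trmx_drsub kT.
- have ta : t ^+ 2 * s ^+ 2 = 1 by rewrite -exprMn ts expr1n.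
  apply: contraNneq k0; rewrite kE !det_map_mx (pivot_schur_det _ _ ta) rmorphM.
  by move=> ->; rewrite mulr0.
by rewrite kE; eexists; apply: gram_block hB.
Qed.

End SumOfSquares.

(** * A differentiable branch of the square root *)

Section Root.
Variables (K : numFieldType) (sqrt : K -> K).
Hypothesis sqrtK : forall w, sqrt w ^+ 2 = w.

(** The square root of [w] that is the closer one to [c].  Near [c ^+ 2], for
    nonzero [c], this selects a continuous branch, and only the norm is needed to see it. *)
Definition root_near (c w : K) : K :=
  if `|sqrt w - c| <= `|sqrt w + c| then sqrt w else - sqrt w.

Lemma root_nearK c w : root_near c w ^+ 2 = w.
Proof. by rewrite /root_near; case: ifP; rewrite ?sqrrN sqrtK. Qed.

Lemma root_near_closer c w : `|root_near c w - c| <= `|root_near c w + c|.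
Proof.
rewrite /root_near; case: ifPn => //; rewrite -real_ltNge ?normr_real // => /ltW.
by rewrite -opprD normrN addrC -[X in _ <= X]normrN opprD opprK (addrC c).
Qed.

(** Writing [r] for the chosen root, [w - c ^+ 2 = (r - c) * (r + c)], and the
    choice of [r] forces [`|c| <= `|r + c|]: indeed
    [2 * `|c| <= `|r - c| + `|r + c| <= 2 * `|r + c|]. *)
Lemma root_near_dist c w : `|c| * `|root_near c w - c| <= `|w - c ^+ 2|.
Proof.
rewrite -{2}(root_nearK c w) subr_sqr normrM mulrC ler_wpM2l //.
rewrite -(ler_pM2l (ltr0Sn K 1)) !mulr_natl -normrMn.
have -> : c *+ 2 = (root_near c w + c) - (root_near c w - c).
  by rewrite opprB addrC addrA subrK mulr2n.
by apply: (le_trans (ler_normB _ _)); rewrite mulr2n lerD2l root_near_closer.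
Qed.

(** Here [w' - w] is the product of the difference and the sum of the two roots,
    and this sum stays away from 0 because both roots are close to [c]. *)
Lemma root_near_lipschitz c w w' :
  `|root_near c w - c| + `|root_near c w' - c| <= `|c| ->
  `|c| * `|root_near c w' - root_near c w| <= `|w' - w|.
Proof.
move=> wc; rewrite -{2}(root_nearK c w) -{2}(root_nearK c w') subr_sqr normrM.
rewrite mulrC ler_wpM2l //.
move: wc; set r := root_near c w; set r' := root_near c w' => wc.
rewrite -(lerD2r `|c|) -mulr2n -normrMn.
have -> : c *+ 2 = (r' + r) - ((r - c) + (r' - c)).
  by ring.
rewrite (le_trans (ler_normB _ _)) // lerD2l.
by rewrite (le_trans (ler_normD _ _)).
Qed.

Lemma root_near_ball c w : c != 0 -> `|w - c ^+ 2| < `|c| ^+ 2 / 2 ->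
  `|root_near c w - c| < `|c| / 2.
Proof.
move=> c0 wc; have := le_lt_trans (root_near_dist c w) wc.
by rewrite expr2 -mulrA ltr_pM2l ?normr_gt0.
Qed.

Lemma root_near_continuous c w : c != 0 -> `|w - c ^+ 2| < `|c| ^+ 2 / 2 ->
  {for w, continuous (root_near c)}.
Proof.
move=> c0 wc; apply/(@cvgrPdist_lt _ K _ (nbhs w)) => e e0.
have openD : \forall w' \near w, `|w' - c ^+ 2| < `|c| ^+ 2 / 2.
  have wcc : w' - c ^+ 2 @[w' --> w] --> w - c ^+ 2.
    apply: (@cvgB _ K _ (nbhs w) _ id (cst _)); first exact: cvg_id.
    exact: cvg_cst.
  exact: (@cvgr_norm_lt _ _ _ (nbhs w) _ _ _ wcc).
near=> w'.
rewrite distrC -(@ltr_pM2l _ `|c|) ?normr_gt0 //.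
apply: (@le_lt_trans _ _ `|w' - w|).
  apply: root_near_lipschitz; rewrite [leRHS]splitr ltW // ltrD //.
    exact: root_near_ball.
  by apply: root_near_ball => //; near: w'.
rewrite distrC; near: w'; apply: cvgr_dist_lt; first exact: cvg_id.
by rewrite mulr_gt0 ?normr_gt0.
Unshelve. all: by end_near. Qed.

(** The difference quotient of a square root is the inverse of the sum of its
    values at the two points, so continuity alone yields the derivative
    [(r w + r w)^-1]. *)
Lemma square_root_differentiable (r : K -> K) w :
  (forall x, r x ^+ 2 = x) -> w != 0 -> {for w, continuous r} ->
  differentiable r w.
Proof.
move=> rK w0 rc; apply/derivable1_diffP.
have rw0 : r w + r w != 0.
  rewrite -mulr2n mulrn_eq0 /=; apply: contra_neq w0 => rw.
  by rewrite -(rK w) rw expr0n.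
apply: (cvgP ((r w + r w)^-1)).
have rcw : r (h + w) @[h --> 0^'] --> r w by exact/continuous_withinNshiftx.
have sumc : r (h + w) + r w @[h --> 0^'] --> r w + r w.
  by apply: cvgD => //; exact: cvg_cst.
apply: cvg_trans (cvgV rw0 sumc); apply: near_eq_cvg; near=> h => /=.
have h0 : h != 0 by near: h; exact: nbhs_dnbhs_neq.
have rs0 : r (h + w) + r w != 0 by near: h; exact: cvgr_neq0 sumc _.
apply: (mulIf rs0); rewrite mulVf //.
rewrite /GRing.scale /= mulr1 -mulrA -subr_sqr !rK addrK mulVf //.
Unshelve. all: by end_near. Qed.

End Root.

(** * Units and squares in the ring of germs *)

Section GermRing.
Variables (K : numFieldType) (n : nat).
Implicit Types (f : holo0 K n) (u : germ K n).

Lemma germ_of1 : germ_of (1 : holo0 K n) = 1.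
Proof. exact: rmorph1. Qed.

Lemma germ_at0_zmod_morphism : zmod_morphism (@germ_at0 K n).
Proof.
move=> u v; rewrite -(germ_reprK u) -(germ_reprK v) -[X in germ_at0 X]rmorphB.
by rewrite !germ_at0E.
Qed.

Lemma germ_at0_monoid_morphism : monoid_morphism (@germ_at0 K n).
Proof.
split; first by rewrite -germ_of1 germ_at0E.
by move=> u v; rewrite -(germ_reprK u) -(germ_reprK v) -germ_ofM !germ_at0E.
Qed.

HB.instance Definition _ :=
  GRing.isZmodMorphism.Build _ _ (@germ_at0 K n) germ_at0_zmod_morphism.
HB.instance Definition _ :=
  GRing.isMonoidMorphism.Build _ _ (@germ_at0 K n) germ_at0_monoid_morphism.

Lemma holo0_continuous0 f : f z @[z --> (0 : 'rV[K]_n)] --> f 0.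
Proof. exact/differentiable_continuous/(nbhs_singleton (holo0P f)). Qed.

Lemma germ_inverse u : germ_at0 u != 0 -> exists v, v * u = 1.
Proof.
rewrite -(germ_reprK u) germ_at0E; move: (germ_repr u) => {u} f f0.
have fN0 : \forall z \near (0 : 'rV[K]_n), f z != 0.
  exact: cvgr_neq0 (@holo0_continuous0 f) f0.
have holo : (fun z => (f z)^-1) \in @holo0_pred K n.
  apply/asboolP; near=> z; apply: differentiableV; last by near: z.
  by near: z; exact: holo0P.
exists (germ_of (Holo0 holo)); rewrite -germ_ofM -germ_of1.
apply/germ_ofP; near=> z.
by rewrite -[LHS]/((f z)^-1 * f z) mulVf //; near: z.
Unshelve. all: by end_near. Qed.

Lemma germ_square_root (sqrt : K -> K) u : (forall w, sqrt w ^+ 2 = w) ->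
  germ_at0 u != 0 -> exists s, s ^+ 2 = u.
Proof.
move=> sqrtK; rewrite -(germ_reprK u) germ_at0E.
move: (germ_repr u) => {u} f f0; pose c := sqrt (f 0).
have c0 : c != 0.
  by apply: contra_neq f0 => c0; rewrite -[f 0]sqrtK -/c c0 expr0n.
have fN0 : \forall z \near (0 : 'rV[K]_n), f z != 0.
  exact: cvgr_neq0 (@holo0_continuous0 f) f0.
have fball : \forall z \near (0 : 'rV[K]_n), `|f z - c ^+ 2| < `|c| ^+ 2 / 2.
  rewrite sqrtK; near=> z; rewrite distrC; near: z.
  apply: cvgr_dist_lt (@holo0_continuous0 f) _ _.
  by rewrite divr_gt0 // exprn_gt0 ?normr_gt0.
have holo : (fun z => root_near sqrt c (f z)) \in @holo0_pred K n.
  apply/asboolP; near=> z.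
  apply: (differentiable_comp (g := root_near sqrt c)).
    by near: z; exact: holo0P.
  apply: square_root_differentiable => [x||].
  - exact: root_nearK.
  - by near: z.
  - by apply: root_near_continuous => //; near: z.
exists (germ_of (Holo0 holo)); rewrite expr2 -germ_ofM.
apply/germ_ofP; near=> z.
by rewrite -[LHS]/(root_near sqrt c (f z) ^+ 2) root_nearK.
Unshelve. all: by end_near. Qed.

Lemma sum_squares_compE p (g : 'I_p -> germ K n) :
  germ_comp (\sum_(i < p) zcoord i ^+ 2) g = \sum_(i < p) g i ^+ 2.
Proof.
have -> : \sum_(i < p) g i ^+ 2 = germ_of (\sum_(i < p) germ_repr (g i) ^+ 2).
  rewrite [RHS]raddf_sum; apply: eq_bigr => i _.
  by rewrite -{1}(germ_reprK (g i)) expr2 -germ_ofM.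
apply/germ_ofP; near=> z => /=.
have -> : (\sum_(i < p) zcoord i ^+ 2 : entire K p) (\row_i germ_repr (g i) z)
    = \sum_(i < p) germ_repr (g i) z ^+ 2.
  apply: (big_ind2 (fun (a : entire K p) b =>
    a (\row_i germ_repr (g i) z) = b)) => // [a _ b _ <- <- //|i _].
  by rewrite -[LHS]/((\row_i germ_repr (g i) z) ord0 i ^+ 2) mxE.
by apply: (big_ind2 (fun a (b : holo0 K n) => a = b z))
  => // a b c d -> ->.
Unshelve. all: by end_near. Qed.
End GermRing.

(** * Generators adapted to the quadratic form *)

Lemma ideal_gen_sub (A : comNzRingType) p (g g' : 'I_p -> A) (M : 'M[A]_p) :
  (forall i, g i = \sum_(j < p) M i j * g' j) -> ideal_gen g `<=` ideal_gen g'.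
Proof.
move=> gE _ [a ->]; exists (fun j => \sum_(i < p) a i * M i j).
under eq_bigr do rewrite gE mulr_sumr.
rewrite exchange_big; apply: eq_bigr => j _ /=; rewrite mulr_suml.
by apply: eq_bigr => i _; rewrite mulrA.
Qed.

Theorem mainTheorem14 (R : realType) (n p : nat)
    (I : set (germ R[i] n)) (g : 'I_p -> germ R[i] n)
    (f : germ R[i] n) (h : 'M[germ R[i] n]_p) :
  I = ideal_gen g ->
  f = \sum_(i < p) \sum_(j < p) h i j * g i * g j ->
  (forall i j, h i j = h j i) ->
  \det (map_mx germ_at0 h) != 0 ->
  exists g' : 'I_p -> germ R[i] n,
    I = ideal_gen g' /\
    f = germ_comp (\sum_(i < p) zcoord i ^+ 2) g'.
Proof.
move=> -> -> hsym h0.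
have hT : h^T = h by apply/matrixP => i j; rewrite mxE hsym.
have inv := @germ_inverse R[i] n.
have sqr u := @germ_square_root R[i] n sqrtC u (@sqrtCK _).
have two_neq0 : (2%:R : R[i]) != 0 by rewrite pnatr_eq0.
have [B hB] := symmetric_gram two_neq0 inv sqr hT h0.
have [C CB] : exists C, C *m B = 1%:M.
  apply: (left_inverse_mx inv); apply: contraNneq h0.
  by rewrite hB map_mxM det_mulmx => ->; rewrite mulr0.
pose gv : 'cV_p := \col_i g i.
exists (fun i => (B *m gv) i 0); split.
  apply/seteqP; split; apply: ideal_gen_sub => i.
    have <- : (C *m (B *m gv)) i 0 = g i by rewrite mulmxA CB mul1mx mxE.
    by rewrite mxE.
  by rewrite mxE; apply: eq_bigr => j _; rewrite [gv _ _]mxE.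
rewrite sum_squares_compE.
transitivity (((gv^T *m h) *m gv) 0 0).
  rewrite mxE exchange_big; apply: eq_bigr => j _ /=.
  rewrite mxE mulr_suml; apply: eq_bigr => i _.
  by rewrite !mxE (mulrC (g i)).
rewrite hB !mulmxA -trmx_mul -mulmxA mxE; apply: eq_bigr => i _.
by rewrite [_^T _ _]mxE expr2.
Qed.
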